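(* Let $p$ be a prime and let $L$ be a countable Hausdorff topological vector space over the finite field $\mathbb F_p$. Then there exists a basis of $L$ over $\mathbb F_p$ which is a closed subset of $L$ and is discrete in the topology induced from $L$. Equivalently: any countable Hausdorff Abelian topological group of prime exponent $p$ has a closed discrete basis.
   Context: A basis is understood in the purely algebraic (Hamel) sense: a linearly independent set whose finite linear combinations with coefficients in $\mathbb F_p$ exhaust the space. The field $\mathbb F_p$ carries the discrete topology. An Abelian group of exponent $p$ is regarded as an $\mathbb F_p$-vector space in the natural way (linear combinations and bases being defined accordingly), and any group topology on it is then a vector space topology. A subset is closed discrete if it is closed in the space and discrete in the induced topology. *)

(* Defs.v *)
From HB Require Import structures.
From mathcomp Require Import all_boot all_order all_algebra.
From mathcomp Require Import finmap.
From mathcomp Require Import all_classical all_reals all_analysis.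

Set Implicit Arguments.
Unset Strict Implicit.
Unset Printing Implicit Defensive.

Import GRing.Theory.

Local Open Scope classical_set_scope.
Local Open Scope ring_scope.

(* The library's [topologicalLmodType K] needs an ordered field [K] carrying
   its norm topology, which rules out [K := 'F_p]. The structure below is the
   analogue for an arbitrary field endowed with the discrete topology; no
   separation axiom is included. *)
Record discFieldTvs (K : fieldType) := DiscFieldTvs {
  tvs_group : topologicalZmodType;
  tvs_scale : K -> tvs_group -> tvs_group;
  tvs_scaleA : forall a b x,
    tvs_scale a (tvs_scale b x) = tvs_scale (a * b) x;
  tvs_scale1 : left_id 1 tvs_scale;
  tvs_scaleDr : right_distributive tvs_scale +%R;
  tvs_scaleDl : forall x, {morph tvs_scale^~ x : a b / a + b};
  tvs_scale_continuous :
    continuous (fun z : discrete_topology K * tvs_group => tvs_scale z.1 z.2)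
}.

Definition tvs_sort (K : fieldType) (L : discFieldTvs K) : Type := tvs_group L.
Coercion tvs_sort : discFieldTvs >-> Sortclass.

HB.instance Definition _ (K : fieldType) (L : discFieldTvs K) :=
  TopologicalZmodule.on (tvs_sort L).
HB.instance Definition _ (K : fieldType) (L : discFieldTvs K) :=
  GRing.Zmodule_isLmodule.Build K (tvs_sort L)
    (@tvs_scaleA K L) (@tvs_scale1 K L) (@tvs_scaleDr K L) (@tvs_scaleDl K L).

Definition lin_indep (K : fieldType) (V : lmodType K) (B : set V) : Prop :=
  forall (A : {fset V}) (c : V -> K), [set` A] `<=` B ->
    \sum_(x <- A) c x *: x = 0 -> forall x, x \in A -> c x = 0.

Definition spanning (K : fieldType) (V : lmodType K) (B : set V) : Prop :=
  forall v : V, exists (A : {fset V}) (c : V -> K),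
    [set` A] `<=` B /\ v = \sum_(x <- A) c x *: x.

Definition hamel_basis (K : fieldType) (V : lmodType K) (B : set V) : Prop :=
  lin_indep B /\ spanning B.

(* [set_type B] carries the topology induced from [T]. *)
Definition discrete_subset (T : topologicalType) (B : set T) : Prop :=
  forall U : set (set_type B), open U.

Definition closed_discrete (T : topologicalType) (B : set T) : Prop :=
  closed B /\ discrete_subset B.

Section FpSpace.
Variables (p : nat) (p_pr : prime p) (G : topologicalZmodType).
Hypothesis Gp : forall x : G, x *+ p = 0.

Definition Fp_scale (a : 'F_p) (x : G) : G := x *+ (a : nat).

Let mulrn_modp (x : G) n m : m = p -> x *+ (n %% m)%N = x *+ n.
Proof.
move=> ->.
by rewrite [in RHS](divn_eq n p) mulrnDr mulnC mulrnA Gp mul0rn add0r.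
Qed.

Lemma Fp_scaleA a b x : Fp_scale a (Fp_scale b x) = Fp_scale (a * b) x.
Proof.
by rewrite /Fp_scale /= mulrn_modp ?(Fp_cast p_pr) // mulnC mulrnA.
Qed.

Lemma Fp_scale1 : left_id 1 Fp_scale.
Proof. by move=> x; rewrite /Fp_scale /= mulr1n. Qed.

Lemma Fp_scaleDr : right_distributive Fp_scale +%R.
Proof. by move=> a x y; rewrite /Fp_scale mulrnDl. Qed.

Lemma Fp_scaleDl x : {morph Fp_scale^~ x : a b / a + b}.
Proof.
by move=> a b; rewrite /Fp_scale /= mulrn_modp ?(Fp_cast p_pr) // mulrnDr.
Qed.

Lemma mulrn_continuous n : continuous (fun x : G => x *+ n).
Proof.
elim: n => [|n IHn] x; first exact: cvg_cst.
under eq_fun do rewrite mulrS.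
apply: (@continuous_comp _ _ _ (fun y : G => (y, y *+ n))
  (fun z : G * G => z.1 + z.2)); last exact: add_continuous.
by apply: cvg_pair; [exact: cvg_id|exact: IHn].
Qed.

Lemma Fp_scale_continuous :
  continuous (fun z : discrete_topology 'F_p * G => Fp_scale z.1 z.2).
Proof.
move=> [a x] U /= /(@mulrn_continuous a x) Ux.
exists ([set a], [set y | U (y *+ (a : nat))]).
  by split => //; exact: (@discrete_set1 (discrete_topology 'F_p)).
by move=> [b y] [/= -> Uy].
Qed.

(* A topological abelian group killed by the prime [p], with its natural
   structure of topological ['F_p]-vector space. *)
Definition Fp_tvs : discFieldTvs 'F_p :=
  DiscFieldTvs Fp_scaleA Fp_scale1 Fp_scaleDr Fp_scaleDl Fp_scale_continuous.

End FpSpace.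

(* Main.v *)
Require Import Defs.
From mathcomp Require Import all_boot all_order all_algebra finmap.
From mathcomp Require Import all_classical all_reals all_analysis.

(** A subset of a Hausdorff space that is locally finite (every point has a
neighbourhood meeting it in a finite set) is closed and discrete, and so are
its subsets ([locally_finite_closed_discrete]).  Since every sequence that
spans a vector space contains a basis ([greedy_basis]), it suffices to find a
spanning sequence with locally finite range.

A finite space is itself locally finite.  In an infinite space enumerated as
x_0, x_1, ..., neighbourhoods W_i of the x_i are chosen so thin that, for every
n, each vector is a sum of two vectors lying outside W_0, ..., W_(n-1)
([avoiding_decomposition]).  Writing x_n = a_n + b_n in this way for every n,
the sequence a_0, b_0, a_1, b_1, ... spans, and only its terms with index at
most 2i + 1 can meet W_i.

Thinness is obtained from the pigeonhole principle.  W_i is taken such that no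
two distinct points of it differ by an element of A_i - A_i, where A_i is a
finite set with more than 2 |A_0 + ... + A_(i-1)| elements; such a
neighbourhood exists because a finite set of nonzero vectors is closed.  Then,
by induction on n, every translate of A_0 + ... + A_(n-1) contains a point a
such that both a and g - a avoid W_0, ..., W_(n-1) ([pigeonhole_avoid] is the
inductive step).

The lemmas are stated over an arbitrary field with the discrete topology; a
group of exponent p enters as the space [Fp_tvs]. *)

Import GRing.Theory.

Local Open Scope classical_set_scope.
Local Open Scope ring_scope.

(** [spanning B] says that this set is the whole space; [lspan B] is also used
for the spans of initial segments of a sequence. *)
Definition lspan {K : fieldType} {V : lmodType K} (B : set V) : set V :=
  [set v | exists (A : {fset V}) (c : V -> K),
    [set` A] `<=` B /\ v = \sum_(x <- A) c x *: x].

Section LinearSpan.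
Context {K : fieldType} {V : lmodType K}.
Implicit Types (B : set V) (u v : V).

Lemma lspan_gen B v : B v -> lspan B v.
Proof.
move=> Bv; exists [fset v]%fset, (fun=> 1); split.
  by move=> x /=; rewrite inE => /eqP ->.
by rewrite big_seq_fset1 scale1r.
Qed.

Lemma lspan0 B : lspan B 0.
Proof.
exists fset0, (fun=> 0); split; first by move=> x /=; rewrite inE.
by rewrite big_seq_fset0.
Qed.

Lemma lspanZ B a v : lspan B v -> lspan B (a *: v).
Proof.
move=> [A [c [AB ->]]]; exists A, (fun x => a * c x); split=> //.
by rewrite scaler_sumr; apply: eq_bigr => x _; rewrite scalerA.
Qed.

Lemma lspanD B u v : lspan B u -> lspan B v -> lspan B (u + v).
Proof.
move=> [A1 [c1 [AB1 ->]]] [A2 [c2 [AB2 ->]]].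
(* Both coefficient families are extended by zero to the union. *)
pose ext (A : {fset V}) (c : V -> K) x := if x \in A then c x else 0.
have extE (A C : {fset V}) c : (A `<=` C)%fset ->
    \sum_(x <- A) c x *: x = \sum_(x <- C) ext A c x *: x.
  move=> subAC; rewrite -(big_fset_incl _ subAC); last first.
    by move=> x _ /negbTE xA; rewrite /ext xA scale0r.
  by rewrite big_seq [RHS]big_seq; apply: eq_bigr => x; rewrite /ext => ->.
exists (A1 `|` A2)%fset, (fun x => ext A1 c1 x + ext A2 c2 x); split.
  by move=> x /=; rewrite inE => /orP[/AB1|/AB2].
rewrite (extE A1 (A1 `|` A2)%fset) ?fsubsetUl//.
rewrite (extE A2 (A1 `|` A2)%fset) ?fsubsetUr// -big_split /=.
by apply: eq_bigr => x _; rewrite scalerDl.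
Qed.

Lemma lspan_sum B (I : eqType) (r : seq I) (P : pred I) (F : I -> V) :
  (forall i, i \in r -> P i -> lspan B (F i)) ->
  lspan B (\sum_(i <- r | P i) F i).
Proof.
move=> BF; rewrite big_seq_cond; apply: big_ind; first exact: lspan0.
- by move=> u v; exact: lspanD.
- by move=> i /andP[]; exact: BF.
Qed.

Lemma lspan_trans B C : B `<=` lspan C -> lspan B `<=` lspan C.
Proof.
move=> BC _ [A [c [AB ->]]]; apply: lspan_sum => x xA _.
by apply/lspanZ/BC/AB.
Qed.

(** The basis consists of the terms of the sequence that are not combinations of
the preceding ones: in a nontrivial relation between such terms, the one with
the largest index would be a combination of earlier ones. *)
Lemma greedy_basis (y : nat -> V) : spanning (range y) ->
  exists B, B `<=` range y /\ hamel_basis B.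
Proof.
move=> y_span; pose fresh k := ~ lspan (y @` `I_k) (y k).
exists (y @` fresh); split; first by move=> _ [k _ <-]; exists k.
split; last first.
  move=> v; apply: (lspan_trans _ _ _ _ (y_span v)) => _ [k _ <-].
  elim/ltn_ind: k => k IHk.
  have [yk|] := pselect (lspan (y @` `I_k) (y k)); last first.
    by move=> fk; apply: lspan_gen; exists k.
  by apply: lspan_trans yk => _ [j jk <-]; exact: IHk.
move=> A c AB sum0 x0 x0A.
have [//|cx0] := eqVneq (c x0) 0.
have /choice[idx idxP] (x : V) : exists k, (y @` fresh) x -> fresh k /\ y k = x.
  by have [[k fk yk]|nx] := pselect ((y @` fresh) x); [exists k|exists 0%N].
(* [m] is the term of largest index with a nonzero coefficient. *)
have := @arg_maxnP _ [` x0A]%fset (fun z => c (val z) != 0)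
  (fun z => idx (val z)) cx0.
case=> m cm m_max; set x := val m in cm m_max.
have xA : x \in A by exact: fsvalP.
have [fx yx] := idxP x (AB x xA); case: fx; rewrite yx.
have xE : x = - (c x)^-1 *: \sum_(z <- A | z != x) c z *: z.
  move: sum0; rewrite (bigD1_seq x) //= => /eqP; rewrite addr_eq0 => /eqP cxx.
  by rewrite -[\sum_(_ <- _ | _) _]opprK -cxx scaleNr scalerN opprK scalerA
    mulVf ?scale1r.
rewrite [X in lspan _ X]xE; apply/lspanZ/lspan_sum => z zA zx.
have [->|cz] := eqVneq (c z) 0; first by rewrite scale0r; exact: lspan0.
have [_ yz] := idxP z (AB z zA).
apply/lspanZ/lspan_gen; exists (idx z) => //=.
have le_zx : (idx z <= idx x)%N := m_max [` zA]%fset cz.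
rewrite ltn_neqAle le_zx andbT.
by apply: contraNneq zx => eq_idx; rewrite -yz eq_idx yx.
Qed.

End LinearSpan.

(** Local finiteness passes to subsets, so every subset of [B] is closed: near a
point outside a subset, only finitely many points have to be removed. *)
Lemma locally_finite_closed_discrete (T : topologicalType) (B : set T) :
  hausdorff_space T ->
  (forall x : T, exists2 U, nbhs x U & finite_set (U `&` B)) ->
  closed_discrete B.
Proof.
move=> hT Bfin.
have clsub (C : set T) : C `<=` B -> closed C.
  move=> CB; rewrite -[C]setCK; apply: open_closedC; rewrite openE => x Cx.
  have [U Ux finUB] := Bfin x.
  have clUC : closed (U `&` C).
    apply: (accessible_finite_set_closed.1 (hausdorff_accessible hT)).
    by apply: sub_finite_set finUB => z [Uz /CB].
  have UCx : nbhs x (~` (U `&` C)).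
    by apply: open_nbhs_nbhs; split; [exact: closed_openC|case=> _ /Cx].
  by apply: filterS (filterI Ux UCx) => z [Uz nUCz] Cz; exact: nUCz.
split; first exact: clsub.
move=> U; exists (~` (set_val @` (~` U))).
  by apply: closed_openC; apply: clsub => _ [z _ <-]; exact: set_valP.
apply/seteqP; split => z /=.
  by apply: contra_notP => nUz; exists z.
by move=> Uz [t nUt /val_inj tz]; apply: nUt; rewrite tz.
Qed.

(** The difference map sends (x, x) to 0, and the complement of the finite set
[D] deprived of 0 is a neighbourhood of 0. *)
Lemma separating_nbhs (G : topologicalZmodType) (D : {fset G}) (x : G) :
  hausdorff_space G ->
  exists2 W, nbhs x W & forall u v, W u -> W v -> u - v \in D -> u = v.
Proof.
move=> hG; pose N := ~` [set` (D `\ 0)%fset].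
have N0 : nbhs (x - x) N.
  apply: open_nbhs_nbhs; split; last by rewrite /N /= subrr !inE eqxx.
  apply: closed_openC.
  apply: (accessible_finite_set_closed.1 (hausdorff_accessible hG)).
  exact: finite_fset.
have [[P Q] [/= Px Qx] PQN] := @sub_continuous G (x, x) N N0.
exists (P `&` Q); first exact: filterI.
move=> u v [Pu _] [_ Qv] uvD.
have /= /negP := PQN (u, v) (conj Pu Qv).
by rewrite !inE uvD andbT negbK subr_eq0 => /eqP.
Qed.

(** If every [a + f a] were bad, then one of [a + f a] and [g - (a + f a)] would
lie in [W] for each [a].  Recording [f a] together with which of the two
happens maps [A] to a set with [2 * #|S|] elements; two points with the same
record would give two points of [W] whose difference is, up to sign, the
difference of the two points, against the separation hypothesis. *)
Lemma pigeonhole_avoid (G : zmodType) (S A : {fset G}) (W : set G)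
    (f : G -> G) (g : G) :
  (#|` S| * 2 < #|` A|)%N -> (forall a, a \in A -> f a \in S) ->
  (forall u v a b, W u -> W v -> a \in A -> b \in A -> u - v = a - b -> u = v) ->
  exists2 a, a \in A & ~ W (a + f a) /\ ~ W (g - (a + f a)).
Proof.
move=> ltSA fS Wsep; apply: contrapT => nogood.
pose phi (a : A) : S * bool :=
  ([` fS _ (fsvalP a)]%fset, `[< W (val a + f (val a)) >]).
suff /leq_card : injective phi.
  by rewrite card_prod card_bool -!cardfE leqNgt ltSA.
move=> a b [fab Wab].
have bad (c : A) : ~ W (val c + f (val c)) -> W (g - (val c + f (val c))).
  move=> nWc; apply: contrapT => nWgc; apply: nogood.
  by exists (val c); first exact: fsvalP.
have [Aa Ab] : val a \in A /\ val b \in A by split; exact: fsvalP.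
apply: val_inj; have [Wa|nWa] := pselect (W (val a + f (val a))).
  have Wb : W (val b + f (val b)) by apply/asboolP; rewrite -Wab; apply/asboolP.
  apply: (addIr (f (val a))); rewrite [in RHS]fab.
  apply: (Wsep _ _ (val a) (val b)) => //.
  by rewrite fab opprD addrACA subrr addr0.
have nWb : ~ W (val b + f (val b)).
  by move=> /asboolP; rewrite -Wab => /asboolP.
apply: (addIr (f (val a))); rewrite [in RHS]fab.
apply/oppr_inj/(addrI g).
apply: (Wsep _ _ (val b) (val a)) => //; [exact: bad|exact: bad|].
by rewrite fab opprB addrC addrA addrNK opprD addrACA subrr addr0.
Qed.

(** The neighbourhood [W i] is thin with respect to a finite set [dirs (S i)],
where [S n] is the sum of the first [n] of these sets; the point [a] is found
in [S n].  The size of [dirs (S n)] makes the pigeonhole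
principle applicable to functions from [dirs (S n)] to [S n]. *)
Lemma avoiding_decomposition (G : topologicalZmodType) (x : nat -> G) :
  hausdorff_space G -> infinite_set [set: G] ->
  exists W : nat -> set G, (forall i, nbhs (x i) (W i)) /\
    forall n g, exists a, forall i, (i < n)%N -> ~ W i a /\ ~ W i (g - a).
Proof.
move=> hG infG.
have /choice[big bigP] (n : nat) : exists A : {fset G}, (n <= #|` A|)%N.
  by have [A _ ?] := infinite_set_fset n infG; exists A.
pose dirs (S : {fset G}) := big (#|` S| * 2).+1.
pose S := fix S n := if n is m.+1
  then [fset (a + s)%R | a in dirs (S m), s in S m]%fset else [fset 0]%fset.
have /choice[W WP] (n : nat) : exists W, nbhs (x n) W /\
    forall u v, W u -> W v ->
      u - v \in [fset (a - b)%R | a in dirs (S n), b in dirs (S n)]%fset ->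
      u = v.
  by have [W ? ?] := separating_nbhs G
    [fset (a - b)%R | a in dirs (S n), b in dirs (S n)]%fset (x n) hG; exists W.
exists W; split=> [i|n g]; first by have [] := WP i.
(* The translation by [z] is what makes the induction on [n] go through. *)
suff avoid z : exists2 s, s \in S n &
    forall i, (i < n)%N -> ~ W i (z + s) /\ ~ W i (g - (z + s)).
  by have [s _ sP] := avoid 0; exists (0 + s).
elim: n z => [|n IHn] z; first by exists 0; rewrite ?inE.
have /choice[f fP] (a : G) : exists s, s \in S n /\
    forall i, (i < n)%N -> ~ W i (z + a + s) /\ ~ W i (g - (z + a + s)).
  by have [s ? ?] := IHn (z + a); exists s.
(* Each [a] in [dirs (S n)] comes with [f a] in [S n] such that [z + a + f a]
   avoids the earlier neighbourhoods; one of these points also avoids [W n],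
   whose translate by [- z] is used so as to absorb [z]. *)
have [|||a aA [nW1 nW2]] := @pigeonhole_avoid G (S n) (dirs (S n))
    [set u | W n (z + u)] f (g - z - z).
- exact: bigP.
- by move=> a _; have [] := fP a.
- move=> u v a b Wu Wv aA bA uv; apply: (addrI z).
  apply: (WP n).2 => //; rewrite opprD addrACA subrr add0r uv.
  by apply/imfset2P; exists a => //; exists b.
exists (a + f a).
  by apply/imfset2P; exists a => //; exists (f a) => //; have [] := fP a.
move=> i; rewrite ltnS leq_eqVlt => /predU1P[->|lt_in]; last first.
  by rewrite addrA; exact: (fP a).2.
split=> //; apply: contra_not nW2; congr (W n _).
by rewrite opprD !addrA [z + g]addrC addrK.
Qed.

Lemma countable_enum (T : Type) (t0 : T) :
  countable [set: T] -> exists x : nat -> T, forall t, exists n, x n = t.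
Proof.
move=> /pfcard_geP[T0|/unsquash x]; first by have : set0 t0 by rewrite -T0.
exists x => t; have [n _ xn] := @surj _ _ _ _ x t I.
by exists n.
Qed.

Lemma countable_locally_finite_spanning (K : fieldType) (L : discFieldTvs K) :
  countable [set: L] -> hausdorff_space L ->
  exists y : nat -> L, spanning (range y) /\
    forall v : L, exists2 U, nbhs v U & finite_set (U `&` range y).
Proof.
move=> cL hL.
have [x x_onto] := countable_enum L 0 cL.
have [finL|infL] := pselect (finite_set [set: L]).
  exists x; split=> [v|v].
    by apply: lspan_gen; have [n <-] := x_onto v; exists n.
  by exists setT; [exact: filterT|exact: sub_finite_set finL].
have [W [xW Wavoid]] := avoiding_decomposition L x hL infL.
have /choice[a aP] (n : nat) : exists a, forall i, (i < n)%N ->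
  ~ W i a /\ ~ W i (x n - a) by exact: Wavoid.
pose y k := if odd k then x k./2 - a k./2 else a k./2.
exists y; split=> [v|v].
  have [n <-] := x_onto v.
  have -> : x n = y n.*2 + y n.*2.+1.
    by rewrite /y /= odd_double doubleK uphalf_double addrC subrK.
  by apply: lspanD; apply: lspan_gen; [exists n.*2|exists n.*2.+1].
have [i <-] := x_onto v; exists (W i); first exact: xW.
(* For k >= 2(i + 1), the term [y k] comes from some [x n] with i < n. *)
apply: (@sub_finite_set _ _ (y @` `I_i.+1.*2)); last first.
  exact/finite_image/finite_II.
move=> _ [/[swap] -[k _ <-] Wyk]; exists k => //=.
rewrite ltnNge; apply/negP => le_ik.
have lt_ik : (i < k./2)%N by rewrite geq_half_double.
have [nWa nWb] := aP _ _ lt_ik.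
by move: Wyk; rewrite /y; case: odd.
Qed.

Lemma countable_closed_discrete_basis (K : fieldType) (L : discFieldTvs K) :
  countable [set: L] -> hausdorff_space L ->
  exists B : set L, hamel_basis B /\ closed_discrete B.
Proof.
move=> cL hL.
have [y [y_span y_fin]] := countable_locally_finite_spanning K L cL hL.
have [B [By Bbasis]] := greedy_basis y y_span.
exists B; split=> //; apply: locally_finite_closed_discrete => // v.
have [U Uv finU] := y_fin v; exists U => //.
by apply: sub_finite_set finU => z [Uz /By].
Qed.

Theorem mainTheorem1 (p : nat) (p_pr : prime p) :
  (forall L : discFieldTvs 'F_p,
     countable [set: L] -> hausdorff_space L ->
     exists B : set L, hamel_basis B /\ closed_discrete B)
  /\
  (forall (G : topologicalZmodType) (Gp : forall x : G, x *+ p = 0),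
     countable [set: G] -> hausdorff_space G ->
     exists B : set (Fp_tvs p_pr Gp), hamel_basis B /\ closed_discrete B).
Proof.
split=> [L|G Gp]; first exact: countable_closed_discrete_basis.
exact: (countable_closed_discrete_basis _ (Fp_tvs p_pr Gp)).
Qed.
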